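(* Let $(A,[\cdot,\cdot])$ be a Malcev algebra and let $\alpha,\beta:A\to A$ be two algebra morphisms such that $\alpha\beta=\beta\alpha$. Then $(A,[\cdot,\cdot]',\alpha,\beta)$ is a BiHom-Malcev algebra, where $[\cdot,\cdot]':A\times A\to A$ is defined by $[x,y]'=[\alpha(x),\beta(y)]$ for $x,y\in A$.
   Context: All vector spaces are over an algebraically closed field $\mathbb{K}$ of characteristic $0$. A Malcev algebra is a vector space with a skew-symmetric bilinear bracket satisfying $J(x,y,[x,z])=[J(x,y,z),x]$ for all $x,y,z$, where $J$ is the usual Jacobiator $J(x,y,z)=[x,[y,z]]+[y,[z,x]]+[z,[x,y]]$ (replacing $J$ by $-J$ gives the same identity). For a quadruple $(A,[\cdot,\cdot],\alpha,\beta)$ with $[\cdot,\cdot]$ bilinear and $\alpha,\beta$ linear, the BiHom-Jacobiator is $$J_{\alpha,\beta}(x,y,z)=[\beta^2(x),[\beta(y),\alpha(z)]]+[\beta^2(y),[\beta(z),\alpha(x)]]+[\beta^2(z),[\beta(x),\alpha(y)]].$$ A BiHom-Malcev algebra is a quadruple $(A,[\cdot,\cdot],\alpha,\beta)$, with $\alpha,\beta:A\to A$ linear and $[\cdot,\cdot]$ bilinear, such that for all $x,y,z\in A$: (i) $\alpha\beta=\beta\alpha$; (ii) $\alpha([x,y])=[\alpha(x),\alpha(y)]$ and $\beta([x,y])=[\beta(x),\beta(y)]$; (iii) $[\beta(x),\alpha(y)]=-[\beta(y),\alpha(x)]$; (iv) $J_{\alpha,\beta}(\alpha\beta(x),\alpha\beta(y),[\beta(x),\alpha(z)])=[J_{\alpha,\beta}(\beta(x),\beta(y),\beta(z)),\alpha^2\beta^2(x)]$.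 *)

(* Defs.v *)
From HB Require Import structures.
From mathcomp Require Import all_boot all_order all_algebra.

Set Implicit Arguments.
Unset Strict Implicit.
Unset Printing Implicit Defensive.

Import GRing.Theory.
Local Open Scope ring_scope.

Definition jacobiator (K : fieldType) (A : lmodType K) (br : A -> A -> A)
    (x y z : A) : A :=
  br x (br y z) + br y (br z x) + br z (br x y).

Record is_malcev (K : fieldType) (A : lmodType K) (br : A -> A -> A) : Prop :=
  IsMalcev {
    malcev_bilinear : bilinear_for *:%R *:%R br;
    malcev_skew : forall x y, br x y = - br y x;
    malcev_id : forall x y z,
      jacobiator br x y (br x z) = br (jacobiator br x y z) x
  }.

Record is_algebra_morphism (K : fieldType) (A : lmodType K)
    (br : A -> A -> A) (f : A -> A) : Prop :=
  IsAlgebraMorphism {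
    algebra_morphism_linear : linear f;
    algebra_morphism_br : forall x y, f (br x y) = br (f x) (f y)
  }.

Definition bihom_jacobiator (K : fieldType) (A : lmodType K)
    (br : A -> A -> A) (alpha beta : A -> A) (x y z : A) : A :=
    br (beta (beta x)) (br (beta y) (alpha z))
  + br (beta (beta y)) (br (beta z) (alpha x))
  + br (beta (beta z)) (br (beta x) (alpha y)).

Record is_bihom_malcev (K : fieldType) (A : lmodType K) (br : A -> A -> A)
    (alpha beta : A -> A) : Prop :=
  IsBihomMalcev {
    bihom_malcev_bilinear : bilinear_for *:%R *:%R br;
    bihom_malcev_linear_alpha : linear alpha;
    bihom_malcev_linear_beta : linear beta;
    bihom_malcev_comm : forall x, alpha (beta x) = beta (alpha x);
    bihom_malcev_morph_alpha :
      forall x y, alpha (br x y) = br (alpha x) (alpha y);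
    bihom_malcev_morph_beta :
      forall x y, beta (br x y) = br (beta x) (beta y);
    bihom_malcev_skew :
      forall x y, br (beta x) (alpha y) = - br (beta y) (alpha x);
    bihom_malcev_id : forall x y z,
      bihom_jacobiator br alpha beta
        (alpha (beta x)) (alpha (beta y)) (br (beta x) (alpha z))
      = br (bihom_jacobiator br alpha beta (beta x) (beta y) (beta z))
           (alpha (alpha (beta (beta x))))
  }.

(* Main.v *)
Require Import Defs.
From mathcomp Require Import all_boot all_order all_algebra.
Local Open Scope ring_scope.

(* Writing w = alpha beta^2, the BiHom-Jacobiator of the twisted bracket is J(w x, w y, w z),
   so the BiHom-Malcev identity at x, y, z is the Malcev identity at the images of x, y, z
   under alpha^2 beta^3. *)

Theorem theorem2p1 (K : closedFieldType) (hK : [pchar K] =i pred0)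
    (A : lmodType K) (br : A -> A -> A) (alpha beta : A -> A)
    (hA : is_malcev br)
    (halpha : is_algebra_morphism br alpha)
    (hbeta : is_algebra_morphism br beta)
    (hcomm : forall x : A, alpha (beta x) = beta (alpha x)) :
  is_bihom_malcev (fun x y : A => br (alpha x) (beta y)) alpha beta.
Proof.
case: hA => -[bl bR] sk mal; case: halpha => la ma; case: hbeta => lb mb.
(* The twisted bracket applies [alpha] to its left argument, which on the right of the last identity
   is a sum of three brackets. *)
have aD x y : alpha (x + y) = alpha x + alpha y.
  by have := la 1 x y; rewrite !GRing.scale1r.
split=> //.
- split=> [u c x y|u c x y] /=; first by rewrite la; apply: bl.
  by rewrite lb; apply: bR.
- by move=> x y; rewrite ma hcomm.
- by move=> x y; rewrite mb hcomm.
(* Commuting the maps reduces this to skew-symmetry of [br] at [beta (alpha x)] and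
   [beta (alpha y)]. *)
- by move=> x y; rewrite hcomm sk hcomm.
(* Pushing the maps inside the brackets, with [beta] kept outside [alpha], leaves on each variable
   the same word, three [beta] around two [alpha]. What remains is [mal] with [jacobiator]
   unfolded. *)
- move=> x y z; rewrite /bihom_jacobiator !(aD, ma, mb, hcomm).
  exact: mal.
Qed.
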